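(* Let $F$ be a totally real number field of degree $n$ over $\mathbb{Q}$, let $\nu\in\mathcal{O}_F^*$ be totally positive and let $\mathcal{I}\subseteq\mathcal{O}_F$ be a non-zero integral ideal, both fixed. Then there exists a positive constant $k_0$ such that for all integers $k>k_0$ (with $k>2$), the Hilbert Poincaré series $\mathcal{P}_{\vec{k},\nu,\mathcal{I}}$ of parallel weight $\vec{k}=(k,\dots,k)$ is not identically zero.
   Context: $F$ has real embeddings $\sigma_1,\dots,\sigma_n$; $\alpha_j=\sigma_j(\alpha)$; $\alpha\gg0$ means all $\alpha_j>0$. $\mathcal{O}_F^*=\{\mu\in F:\mathrm{tr}(\mu\mathcal{O}_F)\subseteq\mathbb{Z}\}$. $SL_2(\mathcal{O}_F)$ acts on $\mathbb{H}^n$ componentwise via the embeddings by Möbius transformations. For $M=\begin{pmatrix}*&*\\ \gamma&\delta\end{pmatrix}\in SL_2(\mathcal{O}_F)$, $z\in\mathbb{H}^n$, $k\in\mathbb{Z}^n$: $\mu(M,z)^{k}=\prod_{j}(\gamma_jz_j+\delta_j)^{k_j}$; $\mathrm{tr}(mz)=\sum_j m_jz_j$. $\Gamma_0(\mathcal{I})=\{\begin{pmatrix}\alpha&\beta\\ \gamma&\delta\end{pmatrix}\in SL_2(\mathcal{O}_F):\gamma\in\mathcal{I}\}$, $\Gamma_\infty=\{\begin{pmatrix}1&\mu\\0&1\end{pmatrix}:\mu\in\mathcal{O}_F\}$. For $k$ with all $k_j>2$ and totally positive $\nu\in\mathcal{O}_F^*$, $\mathcal{P}_{k,\nu,\mathcal{I}}(z)=\sum_{M\in\Gamma_\infty\backslash\Gamma_0(\mathcal{I})}\mu(M,z)^{-k}e^{2\pi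 i\,\mathrm{tr}(\nu(Mz))}$. $\vec{k}=(k,\dots,k)$.
   Formalization: The theorem is stated for weights k with nk even; when n and k are both odd, the terms of the cosets of M and −M cancel and the series is identically zero (e.g. F = Q, k odd), so the claim fails there. *)

(* Defs.v *)
From HB Require Export structures.
From mathcomp Require Export all_boot all_order all_algebra all_field.
From mathcomp Require Export complex.
From mathcomp Require Export all_classical all_reals all_analysis.
From mathcomp Require Import ring.

Set Implicit Arguments.
Unset Strict Implicit.
Unset Printing Implicit Defensive.

Import Order.TTheory GRing.Theory Num.Theory.
Local Open Scope classical_set_scope.
Local Open Scope ring_scope.

Section Complex.
Variable R : realType.

Definition expC (z : R[i]) : R[i] :=
  (expR (complex.Re z))%:C%C *
  (cos (complex.Im z) +i* sin (complex.Im z))%C.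

(* Unconditional summation: convergence along the directed set of finite
   subsets of D; for complex families this is absolute summability. *)
Definition has_sum (T : choiceType) (D : set T) (f : T -> R[i]) (s : R[i]) :=
  forall e : R, 0 < e ->
  exists2 A0, fsets D A0 &
    forall A, fsets D A -> A0 `<=` A ->
      `|\sum_(i \in A) f i - s| < e%:C%C.

(* 0 when the family is not summable. *)
Definition csum (T : choiceType) (D : set T) (f : T -> R[i]) : R[i] :=
  xget 0 [set s | has_sum D f s].

End Complex.

Section NumberField.
Variable F : fieldExtType rat.

Definition ring_of_integers : set F :=
  [set x | integralOver (intr : int -> F) x].

Definition integral_ideal (I : set F) :=
  [/\ I `<=` ring_of_integers, I 0,
      forall x y, I x -> I y -> I (x + y) &
      forall a x, ring_of_integers a -> I x -> I (a * x)].

Definition nonzero_ideal (I : set F) := exists2 x, I x & x != 0.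

Definition SL2_OF : set 'M[F]_2 :=
  [set M : 'M[F]_2 | (forall i j, ring_of_integers (M i j)) /\ \det M = 1].

Definition Gamma0 (I : set F) : set 'M[F]_2 :=
  [set M : 'M[F]_2 | SL2_OF M /\ I (M 1 0)].

Definition Gamma_inf : set 'M[F]_2 :=
  [set T : 'M[F]_2 |
    [/\ T 0 0 = 1, ring_of_integers (T 0 1), T 1 0 = 0 & T 1 1 = 1]].

Definition Gamma_inf_coset (M : 'M[F]_2) : set 'M[F]_2 :=
  [set T *m M | T in Gamma_inf].

(* Gamma_inf \ Gamma0 I, each class being a set of matrices. *)
Definition Gamma_inf_quot (I : set F) : set (set 'M[F]_2) :=
  Gamma_inf_coset @` Gamma0 I.

End NumberField.

Section Embeddings.
Variables (F : fieldExtType rat) (R : realType).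

Definition totally_real :=
  forall (tau : {rmorphism F -> R[i]}) (x : F), tau x \is Num.real.

Variables (n : nat) (sigma : 'I_n -> {rmorphism F -> R}).

Definition enumerates_real_embeddings :=
  forall tau : {rmorphism F -> R}, exists! j, tau =1 sigma j.

Definition totally_positive (a : F) := forall j, 0 < sigma j a.

Definition trF (a : F) : R := \sum_(j < n) sigma j a.

(* O_F^*, the inverse different. *)
Definition dual_of_integers : set F :=
  [set m | forall x, ring_of_integers x -> trF (m * x) \is a Num.int].

Definition upper_half_space : set ('I_n -> R[i]) :=
  [set z | forall j, 0 < complex.Im (z j)].

Definition cemb (j : 'I_n) (a : F) : R[i] := (sigma j a)%:C%C.

Definition moebius (M : 'M[F]_2) (z : 'I_n -> R[i]) : 'I_n -> R[i] :=
  fun j => (cemb j (M 0 0) * z j + cemb j (M 0 1)) /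
           (cemb j (M 1 0) * z j + cemb j (M 1 1)).

(* mu(M, z) ^ k *)
Definition mu_pow (M : 'M[F]_2) (z : 'I_n -> R[i]) (k : 'I_n -> int) : R[i] :=
  \prod_(j < n) (cemb j (M 1 0) * z j + cemb j (M 1 1)) ^ k j.

Definition tr_mul (a : F) (z : 'I_n -> R[i]) : R[i] :=
  \sum_(j < n) cemb j a * z j.

Definition poincare_term (k : 'I_n -> int) (nu : F) (z : 'I_n -> R[i])
    (M : 'M[F]_2) : R[i] :=
  mu_pow M z (fun j => - k j) *
  expC ((2 * pi)%:C%C * 'i%C * tr_mul nu (moebius M z)).

(* Each class contributes the term of a chosen representative; for nu in O_F^*
   the term does not depend on the choice. *)
Definition hilbert_poincare (k : 'I_n -> int) (nu : F) (I : set F)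
    (z : 'I_n -> R[i]) : R[i] :=
  csum (Gamma_inf_quot I) (fun C => poincare_term k nu z (xget 1%:M C)).

End Embeddings.

Unset Implicit Arguments.

Lemma has_sum_odd (R : realType) (T : choiceType) (D : set T) (f : T -> R[i]) s (i : T -> T) :
  involutive i -> (forall x, D x -> D (i x)) -> (forall x, D x -> f (i x) = - f x) ->
  has_sum D f s -> s = 0.
Proof.
move=> ii Di fi hs; apply/eqP; rewrite -normr_eq0; apply/negPn/negP => s0.
have ps : 0 < complex.Re `|s|.
  by move: s0; rewrite -normr_gt0 normr_id; case: s {hs} => a b; rewrite normc_def ltcE /= => /andP[].
have [A0 [fA0 A0D] hA] := hs _ ps.
have D2 : i @` A0 `<=` D by move=> _ [x /A0D Dx <-]; exact: Di.
have fA : finite_set (A0 `|` i @` A0) by rewrite finite_setU; split => //; exact: finite_image.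
have AD : (A0 `|` i @` A0) `<=` D by move=> x [/A0D|/D2].
have := hA (A0 `|` i @` A0) (conj fA AD) (@subsetUl _ _ _).
suff -> : \sum_(j \in A0 `|` i @` A0) f j = 0.
  rewrite sub0r normrN; case: s {hs hA ps s0} => a b; rewrite normc_def ltcE /=.
  by rewrite ltxx andbF.
set A := A0 `|` _ in fA AD *.
have bi : set_bij A A i.
  split.
  - move=> x [Ax|[y Ay <-]]; [right; by exists x|left; by rewrite ii].
  - by move=> x y _ _ /(congr1 i); rewrite !ii.
  - by move=> x [Ax|[y Ay <-]]; [exists (i x); [right; exists x|rewrite ii]|exists y => //; left].
have E : \sum_(j \in A) f j = - \sum_(j \in A) f j.
  rewrite [LHS](reindex_fsbig i A A) //.
  rewrite !fsbig_finite //= -sumrN big_seq_cond [RHS]big_seq_cond.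
  apply: eq_bigr => x; rewrite andbT in_fset_set // inE => Ax.
  by rewrite fi //; apply: AD.
apply/eqP; move/eqP: E; rewrite -addr_eq0 -mulr2n mulrn_eq0 /=. done.
Qed.

Section OddWeight.
Variable R : realType.

Lemma expCD (a b : R[i]) : expC (a + b) = expC a * expC b.
Proof.
case: a b => a b [c d]; rewrite /expC /= expRD cosD sinD; simpc.
by congr (_ +i* _)%C; ring.
Qed.

Lemma cos_sin_2pin (n : nat) : cos (2 * pi * n%:R : R) = 1 /\ sin (2 * pi * n%:R : R) = 0.
Proof.
elim: n => [|n [hc hs]]; first by rewrite mulr0 cos0 sin0.
have -> : 2 * pi * n.+1%:R = 2 * pi * n%:R + pi *+ 2 :> R.
  by rewrite -(addn1 n) natrD mulrDr mulr1 (mulr_natl pi 2).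
by rewrite cosD2pi sinD2pi.
Qed.

Lemma expC_2pi_int (x : R) : x \is a Num.int ->
  expC ((2 * pi)%:C%C * 'i%C * x%:C%C : R[i]) = 1.
Proof.
case/intrP => m ->.
have -> : ((2 * pi)%:C%C * 'i%C * (m%:~R : R)%:C%C : R[i]) = (0 +i* (2 * pi * m%:~R))%C.
  by simpc.
rewrite /expC /= expR0.
have [->->] : cos (2 * pi * m%:~R : R) = 1 /\ sin (2 * pi * m%:~R : R) = 0.
  case: m => n; first exact: cos_sin_2pin.
  by rewrite NegzE mulrNz mulrN cosN sinN; have [->->] := cos_sin_2pin n.+1; rewrite oppr0.
by simpc.
Qed.

Variables (F : fieldExtType rat) (n : nat) (sigma : 'I_n -> {rmorphism F -> R}).
Variables (nu : F) (I : set F).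
Hypothesis nuD : dual_of_integers sigma nu.
Variable z : 'I_n -> R[i].
Hypothesis zH : upper_half_space z.

Notation den M j := (cemb sigma j (M 1 0) * z j + cemb sigma j (M 1 1)).

Lemma det_mx2 (M : 'M[F]_2) : \det M = M 0 0 * M 1 1 - M 0 1 * M 1 0.
Proof.
have i0 : (ord0 : 'I_2) = 0 by apply/val_inj.
have i1 : lift (ord0 : 'I_2) (ord0 : 'I_1) = 1 by apply/val_inj.
have i2 : lift (1 : 'I_2) (ord0 : 'I_1) = 0 by apply/val_inj.
rewrite (expand_det_row _ 0) !big_ord_recl big_ord0 /cofactor !det_mx11 !mxE ?i1 ?i0 ?i2 /= ?i1.
by rewrite expr0 /= expr1 addr0 mul1r mulN1r mulrN.
Qed.

Lemma den_neq0 (M : 'M[F]_2) j : \det M = 1 -> den M j != 0.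
Proof.
move=> dM; apply/eqP; have := zH j; rewrite /cemb; case: (z j) => x y /= y0.
simpc => -[h1 /eqP]; rewrite mulf_eq0 (gt_eqF y0) orbF fmorph_eq0 => /eqP h2.
move: h1; rewrite h2 rmorph0 mul0r add0r => /eqP; rewrite fmorph_eq0 => /eqP h3.
by move: dM; rewrite det_mx2 h2 h3 !mulr0 subr0 => /esym/eqP; rewrite oner_eq0.
Qed.

Lemma mul_Gamma_inf (T M : 'M[F]_2) : Gamma_inf T ->
  [/\ (T *m M) 0 0 = M 0 0 + T 0 1 * M 1 0, (T *m M) 0 1 = M 0 1 + T 0 1 * M 1 1,
     (T *m M) 1 0 = M 1 0 & (T *m M) 1 1 = M 1 1].
Proof.
move=> [a b c d].
have i0 : (ord0 : 'I_2) = 0 by apply/val_inj.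
have i1 : lift (ord0 : 'I_2) (ord0 : 'I_1) = 1 by apply/val_inj.
by split; rewrite !mxE !big_ord_recl big_ord0 i1 i0 ?a ?c ?d ?mul1r ?mul0r ?addr0 ?add0r.
Qed.

Lemma poincare_termT k (T M : 'M[F]_2) : Gamma_inf T -> \det M = 1 ->
  poincare_term sigma k nu z (T *m M) = poincare_term sigma k nu z M.
Proof.
move=> GT dM; have [e1 e2 e3 e4] := mul_Gamma_inf T M GT.
rewrite /poincare_term; congr (_ * _).
  by rewrite /mu_pow; apply: eq_bigr => j _; rewrite e3 e4.
have -> : tr_mul sigma nu (moebius sigma (T *m M) z) =
   tr_mul sigma nu (moebius sigma M z) + (trF sigma (nu * T 0 1))%:C%C.
  rewrite /tr_mul /trF rmorph_sum -big_split /=; apply: eq_bigr => j _.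
  rewrite /moebius e1 e2 e3 e4 rmorphM rmorphM -!/(cemb sigma j _) -mulrDr.
  congr (_ * _); have := den_neq0 M j dM; rewrite /cemb !rmorphD !rmorphM /=.
  by move=> h; field.
rewrite mulrDr expCD expC_2pi_int ?mulr1 //.
by apply: nuD; case: GT.
Qed.

Lemma poincare_termN (k : int) (M : 'M[F]_2) : \det M = 1 -> ~~ (2 %| n%:Z * k)%Z ->
  poincare_term sigma (fun=> k) nu z (- M) = - poincare_term sigma (fun=> k) nu z M.
Proof.
move=> dM od; rewrite /poincare_term -mulNr; congr (_ * expC (_ * _)).
  rewrite /mu_pow.
  transitivity (\prod_(j < n) ((-1) ^ (- k) * den M j ^ (- k))).
    apply: eq_bigr => j _; rewrite !mxE.
    rewrite -(@exprzMl _ (-1) (den M j)) ?unitfE ?oppr_eq0 ?oner_eq0 ?den_neq0 //.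
    by rewrite /cemb !rmorphN; congr (_ ^ _); ring.
  rewrite big_split /= prodr_const card_ord -[RHS]mulN1r; congr (_ * _).
  have sgn (l : int) : (-1 : R[i]) ^ l = (-1) ^+ odd `|l|%N.
    case: l => m; first by rewrite -exprnP -[LHS]signr_odd.
    by rewrite NegzE abszN -exprnN -exprVn invrN1 -[LHS]signr_odd.
  rewrite sgn abszN -exprM mulnC -signr_odd oddM oddb -oddM.
  by move: od; rewrite dvdzE abszM /= dvdn2 negbK => ->.
rewrite /tr_mul; apply: eq_bigr => j _; congr (_ * _).
rewrite /moebius !mxE /cemb !rmorphN !mulNr -!opprD invrN mulrNN //.
Qed.

Lemma poincare_term_rep k C M : Gamma0 I M -> C = Gamma_inf_coset M ->
  poincare_term sigma k nu z (xget 1%:M C) = poincare_term sigma k nu z M.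
Proof.
move=> [[_ dM] _] ->; case: xgetP => [N _ [T GT <-]|/(_ M)]; first exact: poincare_termT.
case; exists 1%:M; rewrite ?mul1mx //; split; rewrite !mxE //=.
rewrite mulr0n; exact: mxpoly.integral0.
Qed.

(* -1 lies in Gamma0 I and mu(-1, z) ^ (k, ..., k) = (-1) ^ (n k), so for n k
   odd the terms of M and - M cancel. *)
Lemma hilbert_poincare_odd (k : int) : integral_ideal I -> ~~ (2 %| n%:Z * k)%Z ->
  hilbert_poincare sigma (fun=> k) nu I z = 0.
Proof.
move=> [_ _ _ idM] od; rewrite /hilbert_poincare /csum; case: xgetP => // s _ /= hs.
have intN (x : F) : ring_of_integers x -> ring_of_integers (- x).
  exact: mxpoly.integral_opp.
have GN M : Gamma0 I M -> Gamma0 I (- M).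
  move=> [[h1 dM] h2]; split; [split|].
  - by move=> i j; rewrite mxE; apply: intN.
  - by move: dM; rewrite !det_mx2 !mxE !mulrNN.
  - rewrite mxE -mulN1r; apply: idM => //; apply: intN; exact: mxpoly.integral1.
have cN M : [set - N | N in Gamma_inf_coset M] = Gamma_inf_coset (- M).
  apply/seteqP; split => N /=.
  - by move=> [_ [T GT <-] <-]; exists T => //; rewrite mulmxN.
  - by move=> [T GT <-]; exists (T *m M); [exists T|rewrite mulmxN].
apply: (has_sum_odd R _ _ _ s (fun C => [set - N | N in C]) _ _ _ hs).
- move=> C; apply/seteqP; split=> N /=.
    by move=> [_ [L CL <-] <-]; rewrite opprK.
  by move=> CN; exists (- N); rewrite ?opprK //; exists N.
- by move=> _ [M GM <-]; rewrite cN; exists (- M) => //; exact: GN.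
- move=> C [M GM e]; rewrite (poincare_term_rep _ _ M GM (esym e)) -e cN (poincare_term_rep _ _ (- M) (GN _ GM) erefl).
  by apply: poincare_termN => //; case: GM => -[].
Qed.
End OddWeight.

(* Main.v *)
Require Import Defs.
From mathcomp Require Import ring lra zify.

Set Implicit Arguments.
Unset Strict Implicit.
Unset Printing Implicit Defensive.

Import Order.TTheory GRing.Theory Num.Theory.
Import numFieldNormedType.Exports.
Local Open Scope classical_set_scope.
Local Open Scope ring_scope.

(** Evaluate the series at [z_j = i t / nu_j] with [t] large. The cosets of
    [Gamma_inf] correspond to bottom rows [(g, d)], and with
    [u_j = |g_j z_j + d_j|] the absolute value of the term of [(g, d)] is
    [prod_j u_j^-k exp (- 2 pi t / u_j^2)].
    - The two rows [(0, 1)], [(0, -1)] each contribute [exp (- 2 pi t n)], with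
      equal signs because [n k] is even.
    - For the other rows [(0, d)], [d] is a unit, the terms
      [exp (- 2 pi t tr(d^-2))] do not depend on [k], and [tr(d^-2) > n] by
      AM-GM; as their sum converges at [t = 1], it is negligible for [t] large.
    - If [g <> 0] then [prod_j u_j >= t^n |N(g)| / N(nu) >= 2], so the sum over
      these rows is [O(2^-k)] once [t] is fixed.
    The series converges absolutely at weight [4 n]: the exponentials tame the
    small [u_j], so the term of [(g, d)] is
    [O(prod_j ((1 + g_j^2) (1 + d_j^2))^-n)], and the coordinates
    [tr(nu e_i x)], for a basis [e] of integers, embed the ring of integers into
    [Z^n] with [tr(nu e_i x)^2 = O(prod_j (1 + x_j^2))]. *)

(** * Families with bounded finite sums *)

Section BoundedSums.
Variable R : realDomainType.

Definition bounded_sums (T : eqType) (D : set T) (f : T -> R) (B : R) :=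
  forall s : seq T, uniq s -> (forall x, x \in s -> D x) ->
    \sum_(x <- s) f x <= B.

Lemma bounded_sums_ge0 (T : eqType) (D : set T) (f : T -> R) B :
  bounded_sums D f B -> 0 <= B.
Proof. by move=> fB; have := fB [::] isT; rewrite big_nil; apply. Qed.

Lemma ler_sum_uniq_sub (T : eqType) (s t : seq T) (f : T -> R) :
  uniq s -> uniq t -> {subset s <= t} -> (forall x, x \in t -> 0 <= f x) ->
  \sum_(x <- s) f x <= \sum_(x <- t) f x.
Proof.
move=> us ut st f0.
rewrite (perm_big [seq x <- t | x \in s]) /=; last first.
  apply: uniq_perm; rewrite ?filter_uniq // => x; rewrite mem_filter.
  by case: (boolP (x \in s)) => // /st ->.
rewrite big_filter big_mkcond [leLHS]big_seq [leRHS]big_seq.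
by apply: ler_sum => x /f0; case: ifP.
Qed.

Lemma bounded_sums_le_inj (S T : eqType) (D : set S) (E : set T) (h : S -> T)
    (f : S -> R) (g : T -> R) B :
  (forall x, D x -> E (h x)) ->
  (forall x y, D x -> D y -> h x = h y -> x = y) ->
  (forall x, D x -> f x <= g (h x)) ->
  bounded_sums E g B -> bounded_sums D f B.
Proof.
move=> DE h_inj fg gB s us sD.
apply: (@le_trans _ _ (\sum_(y <- map h s) g y)).
  by rewrite big_map [leLHS]big_seq [leRHS]big_seq; apply: ler_sum => x /sD/fg.
apply: gB; last by move=> _ /mapP[x /sD/DE Ex ->].
by rewrite map_inj_in_uniq // => x y /sD Dx /sD Dy; apply: h_inj.
Qed.

Lemma bounded_sums_le (T : eqType) (D : set T) (f g : T -> R) B :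
  (forall x, D x -> f x <= g x) -> bounded_sums D g B -> bounded_sums D f B.
Proof. by move=> fg; apply: (bounded_sums_le_inj (h := id)). Qed.

Lemma bounded_sums_sub (T : eqType) (D E : set T) (f : T -> R) B :
  D `<=` E -> bounded_sums E f B -> bounded_sums D f B.
Proof. by move=> DE fB s us sD; apply: fB => // x /sD/DE. Qed.

Lemma bounded_sumsZ (T : eqType) (D : set T) (f : T -> R) a B :
  0 <= a -> bounded_sums D f B -> bounded_sums D (fun x => a * f x) (a * B).
Proof. by move=> a0 fB s us sD; rewrite -mulr_sumr ler_wpM2l //; exact: fB. Qed.

Lemma bounded_sumsID (T : eqType) (P : pred T) (D : set T) (f : T -> R) A B :
  bounded_sums [set x | D x /\ P x] f A ->
  bounded_sums [set x | D x /\ ~~ P x] f B -> bounded_sums D f (A + B).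
Proof.
move=> fA fB s us sD; rewrite (bigID P) /= -big_filter -[X in _ + X]big_filter.
apply: lerD; [apply: fA | apply: fB]; rewrite ?filter_uniq // => x.
  by rewrite mem_filter => /andP[Px /sD].
by rewrite mem_filter => /andP[Px /sD].
Qed.

Lemma bounded_sums_prod (S T : eqType) (D : set S) (E : set T) (f : S -> R)
    (g : T -> R) A B :
  (forall x, 0 <= f x) -> (forall y, 0 <= g y) ->
  bounded_sums D f A -> bounded_sums E g B ->
  bounded_sums (D `*` E) (fun p => f p.1 * g p.2) (A * B).
Proof.
move=> f0 g0 fA gB s us sDE.
pose s1 := undup (map fst s); pose s2 := undup (map snd s).
apply: (@le_trans _ _ (\sum_(p <- [seq (x, y) | x <- s1, y <- s2]) f p.1 * g p.2)).
  apply: ler_sum_uniq_sub => //.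
  - by rewrite allpairs_uniq ?undup_uniq // => -[? ?] [? ?] _ _ [-> ->].
  - move=> p ps; apply/allpairsP; exists p.
    by rewrite !mem_undup !map_f // -surjective_pairing.
  - by move=> p _; apply: mulr_ge0.
rewrite big_allpairs /=; under eq_bigr do rewrite -mulr_sumr.
rewrite -mulr_suml; apply: ler_pM.
- exact: sumr_ge0.
- exact: sumr_ge0.
- by apply: fA => [|x]; rewrite ?undup_uniq // mem_undup => /mapP[p /sDE[? _] ->].
- by apply: gB => [|x]; rewrite ?undup_uniq // mem_undup => /mapP[p /sDE[_ ?] ->].
Qed.

Lemma sum_seq_sub (T : choiceType) (s : seq T) (f : T -> R) : uniq s ->
  \sum_(x : seq_sub s) f (val x) = \sum_(x <- s) f x.
Proof.
move=> us; rewrite -big_enum -(big_map val xpredT f) /=; apply: perm_big.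
apply: uniq_perm => // [|x]; first by rewrite map_inj_uniq ?enum_uniq //; apply: val_inj.
apply/mapP/idP => [[y _ ->]|xs]; first exact: valP.
by exists (SeqSub xs); rewrite ?mem_enum.
Qed.

Lemma bounded_sums_ffun (I : finType) (T : choiceType) (f : T -> R) B :
  (forall x, 0 <= f x) -> bounded_sums setT f B ->
  bounded_sums setT (fun c : {ffun I -> T} => \prod_i f (c i)) (B ^+ #|I|).
Proof.
move=> f0 fB s us _.
pose vs := undup (flatten [seq codom c | c : {ffun I -> T} <- s]).
have vsP (c : {ffun I -> T}) i : c \in s -> c i \in vs.
  move=> cs; rewrite mem_undup; apply/flattenP.
  by exists (codom c); [exact: map_f | exact: codom_f].
pose inc (c : {ffun I -> seq_sub vs}) : {ffun I -> T} := [ffun i => val (c i)].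
have inc_inj : injective inc.
  move=> c d /ffunP cd; apply/ffunP => i; apply: val_inj.
  by have := cd i; rewrite !ffunE.
apply: (@le_trans _ _ (\sum_(c <- map inc (enum {: {ffun I -> seq_sub vs}}))
                        \prod_i f (c i))).
  apply: ler_sum_uniq_sub => //.
  - by rewrite (map_inj_uniq inc_inj) enum_uniq.
  - move=> c cs; apply/mapP.
    exists [ffun i => SeqSub (vsP c i cs)]; first by rewrite mem_enum.
    by apply/ffunP => i; rewrite !ffunE.
  - by move=> c _; apply: prodr_ge0.
rewrite big_map big_enum /=; under eq_bigr do under eq_bigr do rewrite ffunE.
rewrite -(bigA_distr_bigA (fun=> f \o val)) prodr_const /=.
rewrite sum_seq_sub ?undup_uniq // lerXn2r ?nnegrE ?sumr_ge0 //.
  exact: bounded_sums_ge0 fB.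
by apply: fB; rewrite ?undup_uniq.
Qed.

Lemma bounded_sums_fsbig (T : choiceType) (D A : set T) (f : T -> R) B :
  bounded_sums D f B -> fsets D A -> \sum_(x \in A) f x <= B.
Proof.
move=> fB [fA AD]; rewrite fsbig_finite //; apply: fB; first exact: finmap.fset_uniq.
by move=> x; rewrite in_fset_set // inE => /AD.
Qed.

End BoundedSums.

Section BoundedSumsPowers.
Variables (R : archiRealFieldType) (T : choiceType).

Lemma bounded_sums_finite_ge (D : set T) (f : T -> R) B a : 0 < a ->
  bounded_sums D f B -> finite_set [set x | D x /\ a <= f x].
Proof.
move=> a0 fB; apply: contrapT => /(infinite_set_fset (Num.bound (B / a))) [A AD].
move=> card_A; have := fB _ (finmap.fset_uniq A) (fun x xA => (AD x xA).1).
apply/negP; rewrite -ltNge.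
apply: (@lt_le_trans _ _ (\sum_(x <- finmap.enum_fset A) a)).
  rewrite big_const_seq count_predT iter_addr_0 -mulr_natl -ltr_pdivrMr //.
  apply: lt_le_trans (archi_boundP _) _; last by rewrite ler_nat.
  by rewrite divr_ge0 ?(bounded_sums_ge0 fB) // ltW.
by rewrite [leLHS]big_seq [leRHS]big_seq; apply: ler_sum => x /AD[].
Qed.

Lemma bounded_sums_sup_lt (D : set T) (f : T -> R) B a : 0 < a ->
  (forall x, D x -> f x < a) -> bounded_sums D f B ->
  exists2 b, 0 <= b < a & forall x, D x -> f x <= b.
Proof.
move=> a0 fa fB.
have a2 : 0 < a / 2 by rewrite divr_gt0.
have finX := bounded_sums_finite_ge a2 fB; set X := [set x | _] in finX.
exists (\big[Num.max/a / 2]_(x <- finmap.enum_fset (fset_set X)) f x).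
  apply/andP; split; first exact: le_trans (ltW a2) (bigmax_ge_id _ _ _ _).
  rewrite big_seq; apply: bigmax_lt => [|x]; first by rewrite gtr_pMr // invf_lt1 ?ltr1n.
  by rewrite in_fset_set // inE => -[Dx _]; exact: fa.
move=> x Dx; have [fx|/ltW fx] := leP (a / 2) (f x).
  by apply: le_bigmax_seq => //; rewrite in_fset_set // inE.
exact: le_trans fx (bigmax_ge_id _ _ _ _).
Qed.

Lemma bounded_sums_exprn (D : set T) (f : T -> R) B e : 0 < e ->
  (forall x, D x -> 0 <= f x < 1) -> bounded_sums D f B ->
  exists N, forall m, (N <= m)%N -> bounded_sums D (fun x => f x ^+ m) e.
Proof.
move=> e0 f01 fB.
have [|b /andP[b0 b1] fb] := bounded_sums_sup_lt ltr01 _ fB.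
  by move=> x /f01/andP[].
have B0 := bounded_sums_ge0 fB.
have b_cvg0 : (GRing.exp b : nat -> R) @ \oo --> (0 : R).
  by apply: cvg_expr; rewrite ger0_norm.
have eB : 0 < e / (1 + B) by rewrite divr_gt0 // ltr_pwDl.
have [N _ bN] := cvgr_lt 0 b_cvg0 _ eB.
exists N.+1 => -[//|m] Nm.
apply: (@bounded_sums_le _ _ _ _ (fun x => b ^+ m * f x)).
  move=> x Dx; have /andP[fx0 _] := f01 x Dx.
  by rewrite exprSr ler_wpM2r // lerXn2r ?nnegrE ?fb.
move=> s us sD; apply: (le_trans (bounded_sumsZ (exprn_ge0 m b0) fB us sD)).
have /ltW bm := bN m Nm.
apply: le_trans (ler_wpM2r B0 bm) _.
by rewrite mulrAC ler_pdivrMr ?ltr_pwDl // ler_wpM2l ?(ltW e0) // lerDr.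
Qed.

End BoundedSumsPowers.

Section InverseSquares.
Variable R : realFieldType.

Lemma bounded_sums_nat_inv_sqr :
  bounded_sums [set: nat] (fun m => (1 + m%:R ^+ 2)^-1 : R) 3.
Proof.
move=> s us _; pose N := (\max_(m <- s) m)%N.
apply: (@le_trans _ _ (\sum_(m <- iota 0 N.+1) (1 + m%:R ^+ 2)^-1)).
  apply: ler_sum_uniq_sub us (iota_uniq _ _) _ _ => [m ms|m _].
    by rewrite mem_iota ltnS (@leq_bigmax_seq _ _ xpredT id).
  by rewrite invr_ge0 addr_ge0 ?sqr_ge0.
apply: (@le_trans _ _ (3 - 2 / N.+1%:R)); last by rewrite gerBl divr_ge0.
elim: N => [|N IH]; first by rewrite big_seq1 expr0n addr0 invr1; lra.
rewrite -[N.+2]addn1 iotaD big_cat /= big_seq1 add0n addn1.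
apply: le_trans (lerD IH (lexx _)) _; rewrite -[N.+2%:R]natr1 -[N.+1%:R]natr1.
have : (0 : R) <= N%:R by [].
move: (N%:R : R) => x x0; rewrite -subr_ge0.
have -> : 3 - 2 / (x + 1 + 1) - (3 - 2 / (x + 1) + (1 + (x + 1) ^+ 2)^-1) =
  (x ^+ 2 + x + 2) / ((x + 1 + 1) * (x + 1) * (1 + (x + 1) ^+ 2)).
  by field; rewrite !gt_eqF //; nra.
by rewrite divr_ge0 // ?mulr_ge0 //; nra.
Qed.

Lemma bounded_sums_int_inv_sqr :
  bounded_sums [set: int] (fun m => (1 + m%:~R ^+ 2)^-1 : R) (3 + 3).
Proof.
have absE (m : int) : (1 + m%:~R ^+ 2)^-1 = (1 + `|m|%N%:R ^+ 2)^-1 :> R.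
  by rewrite natr_absz intr_norm real_normK // num_real.
apply: (@bounded_sumsID _ _ (fun m => 0 <= m)).
all: apply: (bounded_sums_le_inj (h := absz)) bounded_sums_nat_inv_sqr => //.
- by move=> x y [_ x0] [_ y0] /(congr1 Posz); rewrite !gez0_abs.
- by move=> x _; rewrite absE.
- move=> x y [_ /negP/negP]; rewrite -ltNge => x0 [_ /negP/negP]; rewrite -ltNge => y0.
  by move=> /(congr1 Posz); rewrite !ltz0_abs // => /oppr_inj.
- by move=> x _; rewrite absE.
Qed.

End InverseSquares.

(** * Unconditional sums of complex families *)

Section HasSum.
Variables (R : realType) (T : choiceType).
Implicit Types (D : set T) (f : T -> R[i]) (g : T -> R).

Lemma fsets_setU D A0 A1 : fsets D A0 -> fsets D A1 -> fsets D (A0 `|` A1).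
Proof.
move=> [fA0 A0D] [fA1 A1D]; split; first by rewrite finite_setU.
by rewrite subUset.
Qed.

Lemma has_sumD D f1 f2 s1 s2 :
  has_sum D f1 s1 -> has_sum D f2 s2 ->
  has_sum D (fun x => f1 x + f2 x) (s1 + s2).
Proof.
move=> sum1 sum2 e e0; have e2 : 0 < e / 2 by rewrite divr_gt0.
have [A1 DA1 near1] := sum1 _ e2; have [A2 DA2 near2] := sum2 _ e2.
exists (A1 `|` A2); first exact: fsets_setU.
move=> A DA; rewrite subUset => -[A1A A2A]; have [fA _] := DA.
have := near2 _ DA A2A; have := near1 _ DA A1A.
rewrite !fsbig_finite // big_split /= opprD addrACA => lt1 lt2.
apply: le_lt_trans (ler_normD _ _) _.
by rewrite [e]splitr rmorphD ltrD.
Qed.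

Lemma has_sumMl D f s c : has_sum D f s -> has_sum D (fun x => c * f x) (c * s).
Proof.
move=> sum_f e e0; have [c0|c_neq0] := eqVneq c 0.
  exists set0 => [|A [fA _] _]; first by split.
  by rewrite c0 fsbig1 ?mul0r ?subrr ?normr0 ?ltcR // => x _; rewrite mul0r.
have normc : `|c| = (complex.Re `|c|)%:C%C by rewrite RRe_real ?normr_real.
have r0 : 0 < complex.Re `|c| by rewrite -ltcR -normc normr_gt0.
have [A0 DA0 near] := sum_f _ (divr_gt0 e0 r0).
exists A0 => // A DA A0A; have [fA _] := DA.
have := near _ DA A0A; rewrite !fsbig_finite // -mulr_sumr -mulrBr normrM.
by rewrite -ltr_pdivlMl ?normr_gt0 // normc -fmorphV -rmorphM [_^-1 * e]mulrC.
Qed.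

Lemma has_sum_ge0 D g B : (forall x, D x -> 0 <= g x) -> bounded_sums D g B ->
  exists s, has_sum D (fun x => (g x)%:C%C) s.
Proof.
move=> g0 gB; pose E := [set r | exists2 A, fsets D A & r = \sum_(x \in A) g x].
have supE : has_sup E.
  split; first by exists (\sum_(x \in set0) g x), set0 => //; split.
  by exists B => r [A DA ->]; exact: bounded_sums_fsbig gB DA.
exists (sup E)%:C%C => e e0.
have [r [A0 DA0 ->] ltA0] := sup_adherent e0 supE.
exists A0 => // A DA A0A.
have leA : \sum_(x \in A) g x <= sup E by apply: ub_le_sup; [case: supE | exists A].
have leA0A : \sum_(x \in A0) g x <= \sum_(x \in A) g x.
  case: DA DA0 => fA AD [fA0 _]; rewrite !fsbig_finite //.
  apply: ler_sum_uniq_sub; try exact: finmap.fset_uniq.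
    by move=> x; rewrite !in_fset_set // !inE; apply: A0A.
  by move=> x; rewrite in_fset_set // inE => /AD/g0.
have -> : \sum_(x \in A) (g x)%:C%C = (\sum_(x \in A) g x)%:C%C.
  by case: DA => fA _; rewrite !fsbig_finite // -rmorph_sum.
rewrite -rmorphB normc_def /= expr0n addr0 sqrtr_sqr ltcR.
by rewrite ltr_norml; apply/andP; split; lra.
Qed.

(* Splits [f] into the nonnegative parts [max (Re f) 0], [max (- Re f) 0],
   and likewise for the imaginary part. *)
Lemma has_sum_majorant D f g B :
  (forall x, D x -> `|f x| <= (g x)%:C%C) -> bounded_sums D g B ->
  exists s, has_sum D f s.
Proof.
move=> fg gB.
have pos_part (u : T -> R) : (forall x, D x -> `|u x| <= g x) ->
    exists s, has_sum D (fun x => (Num.max (u x) 0)%:C%C) s.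
  move=> ug; apply: (@has_sum_ge0 _ _ B) => [x _|]; first by rewrite le_max lexx orbT.
  by apply: bounded_sums_le gB => x /ug; rewrite ge_max ler_norml => /andP[]; lra.
have real_family (u : T -> R) : (forall x, D x -> `|u x| <= g x) ->
    exists s, has_sum D (fun x => (u x)%:C%C) s.
  move=> ug; have [s1 sum1] := pos_part _ ug.
  have [x Dx|s2 sum2] := pos_part (fun x => - u x); first by rewrite normrN ug.
  exists (s1 + (-1) * s2); have := has_sumD sum1 (has_sumMl (-1) sum2).
  congr has_sum; apply/funext => x; rewrite mulN1r -rmorphB /=.
  by congr (_%:C%C); case: (leP (u x) 0); case: (leP (- u x) 0); lra.
have [|s1 sum1] := real_family (fun x => complex.Re (f x)).
  by move=> x Dx; rewrite -lecR (le_trans (normc_ge_Re _)) ?fg.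
have [|s2 sum2] := real_family (fun x => complex.Im (f x)).
  move=> x Dx; rewrite -lecR -normrN.
  rewrite -[- _]/(complex.Re (- complex.Im (f x) +i* complex.Re (f x))%C).
  apply: le_trans (normc_ge_Re _) (le_trans _ (fg x Dx)).
  by rewrite !normc_def /= sqrrN addrC.
exists (s1 + 'i%C * s2); have := has_sumD sum1 (has_sumMl 'i%C sum2).
by congr has_sum; apply/funext => x; rewrite -complexE.
Qed.

Lemma has_sum_dist D f s A g B : has_sum D f s -> fsets D A ->
  (forall x, D x -> `|f x| <= (g x)%:C%C) -> bounded_sums (D `\` A) g B ->
  `|s - \sum_(x \in A) f x| <= B%:C%C.
Proof.
move=> sum_f DA fg gB; apply/ler_addgt0Pr => e e0.
have eE : e = (complex.Re e)%:C%C by rewrite RRe_real ?gtr0_real.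
have e'0 : 0 < complex.Re e by rewrite -ltcR -eE.
have [A0 DA0 near] := sum_f _ e'0.
have := near (A `|` A0) (fsets_setU DA DA0) (@subsetUr _ _ _).
have [fAA0 AA0D] := fsets_setU DA DA0.
rewrite (fsbigID A _ _ fAA0) setUK; set A1 := _ `&` ~` A.
set head := \sum_(x \in A) f x; set tail := \sum_(x \in A1) f x => lt_e.
have tailB : `|tail| <= B%:C%C.
  have DA1 : fsets (D `\` A) A1.
    split; first by apply: sub_finite_set fAA0; apply: subIsetl.
    by move=> x [/AA0D].
  have := bounded_sums_fsbig gB DA1; rewrite -lecR; apply: le_trans.
  have [fA1 A1D] := DA1; rewrite /tail !fsbig_finite // rmorph_sum.
  apply: le_trans (ler_norm_sum _ _ _) _; rewrite [leLHS]big_seq [leRHS]big_seq.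
  by apply: ler_sum => x; rewrite in_fset_set // inE => /A1D[/fg].
have -> : s - head = tail - (head + tail - s) by ring.
apply: le_trans (ler_normB _ _) _; apply: lerD => //.
by rewrite eE ltW.
Qed.

End HasSum.

(** * Integers of a totally real field *)

(* If [a x^d + b x^(d-1) + ...] vanishes, multiply by [a^(d-1)]: then
   [y := a x] is a root of the monic [y^d + b y^(d-1) + a c y^(d-2) + ...]. *)
Lemma integral_lead_coef_mul (A K : comNzRingType) (f : {rmorphism A -> K})
    (q : {poly A}) (x : K) :
  root (map_poly f q) x -> integralOver f (f (lead_coef q) * x).
Proof.
have [->|q0] := eqVneq q 0.
  by move=> _; rewrite lead_coef0 rmorph0 mul0r; exact: mxpoly.integral0.
rewrite lead_coefE -(@prednK (size q)) ?size_poly_gt0 //=.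
have sz_q : size q = (size q).-1.+1 by rewrite prednK ?size_poly_gt0.
set d := (size q).-1 in sz_q *; set a := q`_d.
have hornerE : (map_poly f q).[x] = \sum_(i < d.+1) f q`_i * x ^+ i.
  rewrite (@horner_coef_wide _ d.+1) -?sz_q ?size_poly //.
  by apply: eq_bigr => i _; rewrite coef_map.
rewrite /root hornerE.
case: d => [|e] in sz_q a hornerE *.
  rewrite big_ord1 mulr1 => /eqP ->; rewrite mul0r; exact: mxpoly.integral0.
rewrite big_ord_recr /= -/a addr_eq0 => /eqP sum_lt.
exists ('X^(e.+1) + \poly_(i < e.+1) (q`_i * a ^+ (e - i))).
  by rewrite monicE lead_coefDl ?lead_coefXn // size_polyXn ltnS size_poly.
rewrite /root rmorphD /= map_polyXn hornerD hornerXn.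
rewrite (@horner_coef_wide _ e.+1); last exact: leq_trans (size_poly _ _) (size_poly _ _).
rewrite addrC addr_eq0; apply/eqP.
transitivity (f a ^+ e * \sum_(i < e.+1) f q`_i * x ^+ i).
  rewrite mulr_sumr; apply: eq_bigr => i _; rewrite coef_map coef_poly ltn_ord /=.
  rewrite rmorphM rmorphXn exprMn; have le_ie : (i <= e)%N := ltn_ord i.
  by rewrite -[X in _ = f a ^+ X * _](subnK le_ie) exprD; ring.
by rewrite sum_lt mulrN mulrA -exprSr exprMn.
Qed.

Section RingOfIntegers.
Variable L : fieldExtType rat.
Implicit Types x y : L.

Lemma int_poly_root x :
  exists2 q : {poly int}, q != 0 & root (map_poly intr q) x.
Proof.
have /polyOver1P [p Dp] := minPolyOver 1%AS x.
have [q [a a0 Dq]] := rat_poly_scale p.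
have map_q : map_poly (in_alg L) (map_poly intr q) = map_poly intr q :> {poly L}.
  by rewrite -map_poly_comp; apply: eq_map_poly => m; exact: (rmorph_int (in_alg L)).
exists q.
  apply: contraTneq (monic_minPoly 1%AS x) => q0.
  by rewrite Dp Dq q0 !rmorph0 scaler0 rmorph0 monicE lead_coef0 eq_sym oner_eq0.
have := root_minPoly 1%AS x; rewrite Dp Dq /root map_polyZ /= map_q hornerZ.
by rewrite mulf_eq0 scaler_eq0 oner_eq0 orbF invr_eq0 intr_eq0 (negPf a0).
Qed.

Lemma exists_integral_multiple x :
  exists2 a : int, a != 0 & ring_of_integers (a%:~R * x).
Proof.
have [q q0 qx] := int_poly_root x.
by exists (lead_coef q); [rewrite lead_coef_eq0 | exact: integral_lead_coef_mul].
Qed.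

Lemma ring_of_integers0 : ring_of_integers (0 : L).
Proof. exact: mxpoly.integral0. Qed.

Lemma ring_of_integers1 : ring_of_integers (1 : L).
Proof. exact: mxpoly.integral1. Qed.

Lemma ring_of_integersN x :
  ring_of_integers x -> ring_of_integers (- x).
Proof. exact: mxpoly.integral_opp. Qed.

Lemma ring_of_integersD x y :
  ring_of_integers x -> ring_of_integers y -> ring_of_integers (x + y).
Proof. exact: mxpoly.integral_add. Qed.

Lemma ring_of_integersM x y :
  ring_of_integers x -> ring_of_integers y -> ring_of_integers (x * y).
Proof. exact: mxpoly.integral_mul. Qed.

Lemma ring_of_integersX x m :
  ring_of_integers x -> ring_of_integers (x ^+ m).
Proof.
move=> Ox; elim: m => [|m IH]; first exact: ring_of_integers1.
by rewrite exprS; apply: ring_of_integersM.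
Qed.

End RingOfIntegers.

Lemma dedekind_independence (A : nzRingType) (K : idomainType) (I : finType)
    (s : I -> {rmorphism A -> K}) (c : I -> K) :
  (forall i j, s i =1 s j -> i = j) ->
  (forall x, \sum_j c j * s j x = 0) -> forall j, c j = 0.
Proof.
move=> s_inj; have [m] := ubnP #|[pred j | c j != 0]|.
elim: m c => // m IH c /[!ltnS] le_m c0 j0.
apply/eqP/negPn/negP => cj0.
have ci i : i != j0 -> c i = 0.
  move=> ij; apply/eqP/negPn/negP => ci.
  have [y /eqP sy] : exists y, s i y <> s j0 y.
    by apply/existsNP => si_sj0; move: ij; rewrite (s_inj _ _ si_sj0) eqxx.
  suff /(_ i)/eqP : forall j, c j * (s j y - s j0 y) = 0.
    by rewrite mulf_eq0 (negPf ci) subr_eq0 (negPf sy).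
  apply: IH.
    apply: leq_trans le_m; apply: proper_card; apply/properP; split.
      apply/fintype.subsetP => j; rewrite !inE; apply: contra => /eqP ->.
      by rewrite mul0r.
    by exists j0; rewrite !inE ?cj0 // subrr mulr0 eqxx.
  move=> x; transitivity (\sum_j c j * s j (y * x) - s j0 y * \sum_j c j * s j x).
    rewrite mulr_sumr -sumrB; apply: eq_bigr => j _; rewrite rmorphM.
    by rewrite mulrBr mulrBl -!mulrA (mulrCA (c j) (s j0 y)).
  by rewrite !c0 mulr0 subr0.
have := c0 1; rewrite (bigD1 j0) //= rmorph1 mulr1 big1 ?addr0; last first.
  by move=> i /ci ->; rewrite mul0r.
by move/eqP; rewrite (negPf cj0).
Qed.

Lemma prodr_ege1 (R : numDomainType) (I : Type) (r : seq I) (P : pred I) (f : I -> R) :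
  (forall i, P i -> 1 <= f i) -> 1 <= \prod_(i <- r | P i) f i.
Proof. by move=> f1; elim/big_rec: _ => // i x Pi; apply/mulr_ege1/f1. Qed.

Section Embeddings.
Variables (R : realType) (F : fieldExtType rat) (n : nat).
Variable sigma : 'I_n -> {rmorphism F -> R}.

Definition normF (x : F) : R := \prod_j sigma j x.

Definition height (x : F) : R := \prod_j (1 + sigma j x ^+ 2).

Definition embedding_matrix (e : 'I_n -> F) : 'M[R]_n := \matrix_(i, j) sigma j (e i).

Lemma normFM x y : normF (x * y) = normF x * normF y.
Proof. by rewrite /normF -big_split; apply: eq_bigr => j _; rewrite rmorphM. Qed.

Lemma normFX x m : normF (x ^+ m) = normF x ^+ m.
Proof. by rewrite /normF -prodrXl; apply: eq_bigr => j _; rewrite rmorphXn. Qed.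

Lemma normFV x : normF x^-1 = (normF x)^-1.
Proof. by rewrite /normF -prodfV; apply: eq_bigr => j _; rewrite fmorphV. Qed.

Lemma normF_neq0 x : x != 0 -> normF x != 0.
Proof. by move=> x0; apply/prodf_neq0 => j _; rewrite fmorph_eq0. Qed.

Lemma normF_gt0 x : totally_positive sigma x -> 0 < normF x.
Proof. by move=> x_pos; apply: prodr_gt0 => j _; exact: x_pos. Qed.

Lemma height_ge1 x : 1 <= height x.
Proof. by apply: prodr_ege1 => j _; rewrite lerDl sqr_ge0. Qed.

Lemma height_gt0 x : 0 < height x.
Proof. exact: lt_le_trans (height_ge1 x). Qed.

Lemma height_ge0 x : 0 <= height x.
Proof. exact/ltW/height_gt0. Qed.

Lemma sqr_le_height x j : sigma j x ^+ 2 <= height x.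
Proof.
rewrite /height (bigD1 j) //=; apply: (@le_trans _ _ (1 + sigma j x ^+ 2)).
  by rewrite lerDr.
rewrite ler_peMr ?addr_ge0 ?sqr_ge0 //; apply: prodr_ege1 => i _.
by rewrite lerDl sqr_ge0.
Qed.

Lemma normr_trF_le a x :
  `|trF sigma (a * x)| <= (\sum_j `|sigma j a|) * Num.sqrt (height x).
Proof.
apply: le_trans (ler_norm_sum _ _ _) _; rewrite mulr_suml; apply: ler_sum => j _.
rewrite rmorphM normrM ler_wpM2l //.
by rewrite -[leLHS]sqrtr_sqr ler_wsqrtr // sqr_le_height.
Qed.

Lemma det_trace_form (e : 'I_n -> F) (a : F) :
  \det (\matrix_(i, l) trF sigma (a * (e i * e l))) =
  normF a * \det (embedding_matrix e) ^+ 2.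
Proof.
transitivity (\det (embedding_matrix e *m diag_mx (\row_j sigma j a) *m
                    (embedding_matrix e)^T)).
  congr (\det _); apply/matrixP => i l; rewrite mul_mx_diag !mxE.
  by apply: eq_bigr => j _; rewrite !mxE !rmorphM mulrCA mulrA.
rewrite !det_mulmx det_tr det_diag mulrAC -expr2 mulrC; congr (_ * _).
by apply: eq_bigr => j _; rewrite mxE.
Qed.

Hypothesis degF : \dim {:F} = n.
Hypothesis embF : enumerates_real_embeddings sigma.

Lemma deg_gt0 : (0 < n)%N.
Proof. by rewrite -degF adim_gt0. Qed.

(* The equality case of the arithmetic-geometric mean inequality. *)
Lemma trF_gt_deg x : totally_positive sigma x -> normF x = 1 -> x != 1 ->
  n%:R < trF sigma x.
Proof.
move=> x_pos Nx1 x1; have n0 : 0 < n%:R :> R by rewrite ltr0n deg_gt0.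
have := @leif_AGM R 'I_n xpredT (fun j => sigma j x) (fun j _ => ltW (x_pos j)).
rewrite -/(normF x) Nx1 card_ord -/(trF sigma x) => -[le_mean eq_mean].
have mean0 : 0 <= trF sigma x / n%:R.
  by rewrite divr_ge0 // sumr_ge0 // => j _; exact/ltW/x_pos.
have : 1 <= trF sigma x / n%:R.
  by move: le_mean; rewrite -[leLHS](expr1n _ n) ler_pXn2r ?nnegrE ?deg_gt0.
rewrite ler_pdivlMr // mul1r le_eqVlt => /predU1P[trE|//].
move: eq_mean; rewrite -trE divff ?(gt_eqF n0) // expr1n eqxx => /esym/forallP all_eq.
pose j0 := Ordinal deg_gt0.
have sigma_eq j : sigma j x = sigma j0 x by have /forallP/(_ j0)/eqP := all_eq j.
case/eqP: x1; apply: (fmorph_inj (sigma j0)); apply: (mulfI (lt0r_neq0 n0)).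
rewrite rmorph1 mulr1 [RHS]trE /trF; under eq_bigr do rewrite sigma_eq.
by rewrite sumr_const card_ord mulr_natl.
Qed.

Lemma embeddings_inj i j : sigma i =1 sigma j -> i = j.
Proof.
by move=> ij; have [l [_ uniq_l]] := embF (sigma i); rewrite -(uniq_l i) // (uniq_l j).
Qed.

Lemma embedding_scale_rat j (q : rat) (x : F) : sigma j (q *: x) = ratr q * sigma j x.
Proof.
rewrite -mulr_algl rmorphM; congr (_ * _).
exact: (fmorph_eq_rat (sigma j \o in_alg F)).
Qed.

Lemma integral_basis : exists2 e : 'I_n -> F,
  forall i, ring_of_integers (e i) & embedding_matrix e \in unitmx.
Proof.
pose b (i : 'I_n) : F := (vbasis {:F})`_i.
have [a a0 Oab] : exists2 a : 'I_n -> int, forall i, a i != 0 &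
    forall i, ring_of_integers ((a i)%:~R * b i).
  have /choice[a ab] : forall i, exists a : int, a != 0 /\ ring_of_integers (a%:~R * b i).
    by move=> i; have [a ? ?] := exists_integral_multiple (b i); exists a.
  by exists a => i; case: (ab i).
exists (fun i => (a i)%:~R * b i) => //.
rewrite -unitmx_tr unitmxE unitfE; apply/det0P => -[v v_neq0 v0].
have vb i : \sum_j v 0 j * sigma j (b i) = 0.
  have /rowP/(_ i) := v0; rewrite !mxE.
  under eq_bigr do rewrite !mxE rmorphM rmorph_int mulrCA.
  by rewrite -mulr_sumr => /eqP; rewrite mulf_eq0 intr_eq0 (negPf (a0 i)) => /eqP.
move: v_neq0; apply/negP/negPn/eqP/rowP => j; rewrite mxE.
apply: (dedekind_independence (s := sigma) (c := fun j => v 0 j)) => [|x].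
  exact: embeddings_inj.
have -> : x = \sum_(i < \dim {:F}) coord (vbasis {:F}) i x *: (vbasis {:F})`_i.
  by apply: coord_vbasis; rewrite memvf.
under eq_bigr do rewrite rmorph_sum mulr_sumr.
rewrite exchange_big big1 //= => i _.
under eq_bigr do rewrite embedding_scale_rat mulrCA.
by rewrite -mulr_sumr (vb (cast_ord degF i)) mulr0.
Qed.

Variable nu : F.
Hypothesis nu_dual : dual_of_integers sigma nu.
Hypothesis nu_pos : totally_positive sigma nu.

(* The Gram matrix of the form tr(nu g x y) on the lattice spanned by an
   integral basis is a nonsingular integral matrix. *)
Lemma normF_lower_bound : exists2 c : R, 0 < c &
  forall g, ring_of_integers g -> g != 0 -> c <= `|normF g|.
Proof.
have [e Oe e_unit] := integral_basis.
have nu0 := normF_gt0 nu_pos.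
have det0 : \det (embedding_matrix e) != 0 by rewrite -unitfE -unitmxE.
pose d := normF nu * \det (embedding_matrix e) ^+ 2.
have d0 : 0 < d by rewrite mulr_gt0 // exprn_even_gt0.
exists d^-1; first by rewrite invr_gt0.
move=> g Og g0; pose G := \matrix_(i, l) trF sigma (nu * g * (e i * e l)).
have detG : \det G = d * normF g by rewrite det_trace_form normFM mulrAC.
have int_detG : \det G \is a Num.int.
  rewrite /determinant rpred_sum // => s _; rewrite rpredM ?rpred_sign //.
  rewrite rpred_prod // => i _; rewrite mxE -mulrA; apply: nu_dual.
  by do 2!apply: ring_of_integersM => //.
have := norm_intr_ge1 int_detG; rewrite detG mulf_neq0 ?normF_neq0 ?gt_eqF // => /(_ isT).
by rewrite normrM (gtr0_norm d0) -ler_pdivrMl // mulr1.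
Qed.

(* Otherwise the norms of the powers of [g] would tend to [0]. *)
Lemma normF_integer_ge1 g : ring_of_integers g -> g != 0 -> 1 <= `|normF g|.
Proof.
move=> Og g0; have [c c0 c_le] := normF_lower_bound.
rewrite leNgt; apply/negP => lt1.
have pow_cvg0 : (GRing.exp `|normF g| : nat -> R) @ \oo --> (0 : R).
  by apply: cvg_expr; rewrite normr_id.
have [m _ /(_ m (leqnn m))] := cvgr_lt 0 pow_cvg0 _ c0; apply/negP.
by rewrite -leNgt -normrX -normFX c_le ?expf_neq0 //; exact: ring_of_integersX.
Qed.

(* For a basis [e] of integers, the coordinates [tr(nu e_i x)] embed the
   integers into [Z^n]. *)
Lemma integer_coordinates : exists2 C : R, 0 < C &
  exists2 c : F -> {ffun 'I_n -> int},
    forall x y, ring_of_integers x -> ring_of_integers y -> c x = c y -> x = y &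
    forall x i, ring_of_integers x -> 1 + (c x i)%:~R ^+ 2 <= C * height x.
Proof.
have [e Oe e_unit] := integral_basis.
pose c x := [ffun i => Num.floor (trF sigma (nu * (e i * x)))].
have cE x i : ring_of_integers x -> (c x i)%:~R = trF sigma (nu * (e i * x)).
  by move=> Ox; rewrite ffunE floorK //; apply/nu_dual/ring_of_integersM.
have mul_basis x : ring_of_integers x ->
    embedding_matrix e *m \col_j sigma j (nu * x) = \col_i (c x i)%:~R.
  move=> Ox; apply/colP => i; rewrite !mxE cE //; apply: eq_bigr => j _.
  by rewrite !mxE -rmorphM mulrCA.
pose S := \sum_i \sum_j `|sigma j (nu * e i)|.
exists (1 + S ^+ 2); first by rewrite ltr_pwDl ?sqr_ge0.
exists c => [x y Ox Oy cxy | x i Ox].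
  have : embedding_matrix e *m \col_j sigma j (nu * x) =
      embedding_matrix e *m \col_j sigma j (nu * y) by rewrite !mul_basis // cxy.
  move=> /(can_inj (mulKmx e_unit))/colP/(_ (Ordinal deg_gt0)).
  rewrite !mxE => /fmorph_inj/mulfI; apply; apply/eqP => nu0.
  by have := nu_pos (Ordinal deg_gt0); rewrite nu0 rmorph0 ltxx.
have : (c x i)%:~R ^+ 2 <= S ^+ 2 * height x.
  rewrite -(sqr_sqrtr (height_ge0 x)) -exprMn -real_normK ?num_real //.
  have S0 : 0 <= S by do 2!apply: sumr_ge0 => ? _.
  rewrite lerXn2r ?nnegrE ?mulr_ge0 ?sqrtr_ge0 // cE // mulrA.
  apply: le_trans (normr_trF_le _ _) _; rewrite ler_wpM2r ?sqrtr_ge0 //.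
  by rewrite /S [leRHS](bigD1 i) //= lerDl; do 2!apply: sumr_ge0 => ? _.
by have := height_ge1 x; lra.
Qed.

Lemma bounded_sums_height : exists B,
  bounded_sums (@ring_of_integers F) (fun x => (height x)^-1 ^+ n) B.
Proof.
have [C C0 [c c_inj c_le]] := integer_coordinates.
pose w (m : int) : R := (1 + m%:~R ^+ 2)^-1.
have w0 m : 0 <= w m by rewrite invr_ge0 addr_ge0 ?sqr_ge0.
have := bounded_sums_ffun (I := 'I_n) w0 (@bounded_sums_int_inv_sqr R).
move=> /(bounded_sumsZ (exprn_ge0 n (ltW C0))) sum_w.
eexists; apply: (bounded_sums_le_inj (h := c)) sum_w => // x Ox.
rewrite -[n in C ^+ n]card_ord -[n in _^-1 ^+ n]card_ord -!prodr_const -big_split /=.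
apply: ler_prod => i _; rewrite invr_ge0 height_ge0 /=.
by rewrite ler_pdivlMr ?ltr_pwDl ?sqr_ge0 // mulrC ler_pdivrMr ?height_gt0 // c_le.
Qed.

End Embeddings.

(** * Terms of the series at [z_j = i t / nu_j] *)

Section Exponentials.
Variable R : realType.

Lemma norm_expC (z : R[i]) : `|expC z| = (expR (complex.Re z))%:C%C.
Proof.
rewrite /expC normrM !normc_def /= cos2Dsin2 sqrtr1 mulr1 expr0n addr0.
by rewrite sqrtr_sqr ger0_norm ?expR_ge0.
Qed.

Lemma exprn_expRN_le (x : R) m : 0 <= x -> x ^+ m * expR (- x) <= m`!%:R.
Proof.
move=> x0; rewrite expRN ler_pdivrMr ?expR_gt0 //.
case: m => [|m]; first by rewrite expr0 fact0 mul1r -[leLHS]expR0 ler_expR.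
rewrite mulrC -ler_pdivrMr ?ltr0n ?fact_gt0 //.
by apply: le_trans (expR_ge1Dxn m x0); rewrite lerDr.
Qed.

(* With [y = u^-2] the left-hand side times [(1 + u^2)^m] is at most
   [(1 + y)^m exp (- y)]. *)
Lemma exprV_expRN_le (a u : R) m : 1 <= a -> 0 <= u ->
  u^-1 ^+ (2 * m) * expR (- (a * u ^- 2)) <=
  expR 1 * m`!%:R * (1 + u ^+ 2)^-1 ^+ m.
Proof.
move=> a1; rewrite le_eqVlt => /predU1P[<-|u0].
  rewrite !expr0n /= invr0 mulr0 oppr0 expR0 mulr1 addr0 invr1 expr1n mulr1 expr0n.
  apply: (@le_trans _ _ 1); first by case: eqP.
  by rewrite mulr_ege1 ?ler1n ?fact_gt0 // -[leLHS]expR0 ler_expR.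
set y := u ^- 2; have y0 : 0 < y by rewrite invr_gt0 exprn_gt0.
have y1 : 0 <= 1 + y by rewrite addr_ge0 // ltW.
have u2D : 0 < 1 + u ^+ 2 by rewrite ltr_pwDl ?sqr_ge0.
rewrite [(1 + _)^-1 ^+ m]exprVn ler_pdivlMr ?exprn_gt0 //.
have -> : u^-1 ^+ (2 * m) * expR (- (a * y)) * (1 + u ^+ 2) ^+ m =
          (1 + y) ^+ m * expR (- (a * y)).
  rewrite exprM exprVn -/y mulrAC -exprMn; congr (_ ^+ m * _).
  by rewrite mulrDr mulr1 mulVf ?expf_neq0 ?gt_eqF // addrC.
apply: le_trans (_ : (1 + y) ^+ m * (expR 1 * expR (- (1 + y))) <= _).
  by rewrite ler_wpM2l ?exprn_ge0 // -expRD ler_expR; nra.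
by rewrite mulrCA ler_wpM2l ?expR_ge0 // exprn_expRN_le.
Qed.

End Exponentials.

Section PoincareTerm.
Variables (R : realType) (F : fieldExtType rat) (n : nat).
Variables (sigma : 'I_n -> {rmorphism F -> R}) (nu : F).
Hypothesis nu_pos : totally_positive sigma nu.
Implicit Types (t : R) (p : F * F) (M : 'M[F]_2).

Definition base_point t (j : 'I_n) : R[i] := (0 +i* (t / sigma j nu))%C.

Definition den_abs t p j : R :=
  Num.sqrt (sigma j p.2 ^+ 2 + (sigma j p.1 * (t / sigma j nu)) ^+ 2).

Definition term_abs t k p : R :=
  \prod_j ((den_abs t p j)^-1 ^+ k * expR (- (2 * pi * t * den_abs t p j ^- 2))).

Lemma base_point_upper t : 0 < t -> upper_half_space (base_point t).
Proof. by move=> t0 j; rewrite /= divr_gt0 // nu_pos. Qed.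

Lemma norm_den t g d j :
  `|cemb sigma j g * base_point t j + cemb sigma j d| = (den_abs t (g, d) j)%:C%C.
Proof. by rewrite /cemb /base_point normc_def /den_abs; simpc. Qed.

Lemma den_abs_ge0 t p j : 0 <= den_abs t p j.
Proof. exact: sqrtr_ge0. Qed.

Lemma den_abs_sqr t p j :
  den_abs t p j ^+ 2 = sigma j p.2 ^+ 2 + (sigma j p.1 * (t / sigma j nu)) ^+ 2.
Proof. by rewrite sqr_sqrtr // addr_ge0 ?sqr_ge0. Qed.

Lemma ler_fst_den_abs t g d j : 0 <= t ->
  `|sigma j g| * (t / sigma j nu) <= den_abs t (g, d) j.
Proof.
move=> t0; have tnu0 : 0 <= t / sigma j nu by rewrite divr_ge0 // ltW // nu_pos.
rewrite -(ger0_norm tnu0) -normrM -[leLHS]sqrtr_sqr ler_wsqrtr //=.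
by rewrite lerDr sqr_ge0.
Qed.

Lemma Im_moebius_base_point t M j : 0 < t -> \det M = 1 ->
  sigma j nu * complex.Im (moebius sigma M (base_point t) j) =
  t * den_abs t (M 1 0, M 1 1) j ^- 2.
Proof.
move=> t0 dM; have nu0 := nu_pos j.
have : den_abs t (M 1 0, M 1 1) j ^+ 2 != 0.
  rewrite sqrf_eq0; apply: contra_neq (den_neq0 _ _ _ _ _ (base_point_upper t0) M j dM).
  by move=> den0; apply: normr0_eq0; apply: etrans (norm_den _ _ _ _) _; rewrite den0.
rewrite den_abs_sqr /moebius /cemb /base_point /=.
have := congr1 (sigma j) dM; rewrite det_mx2 rmorphB !rmorphM rmorph1.
move: (sigma j (M 0 0)) (sigma j (M 0 1)) (sigma j (M 1 0)) (sigma j (M 1 1)).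
move: (sigma j nu) nu0 => v v0 a b c d det1; simpc => /=.
move: (d ^+ 2 + _) => D D0.
transitivity (t * (a * d - b * c) / D); last by rewrite det1 mulr1.
by field; rewrite D0 gt_eqF.
Qed.

Lemma norm_poincare_term t (k : nat) M : 0 < t -> \det M = 1 ->
  `|poincare_term sigma (fun=> k%:Z) nu (base_point t) M| =
  (term_abs t k (M 1 0, M 1 1))%:C%C.
Proof.
move=> t0 dM; have norm_mu_pow : `|mu_pow sigma M (base_point t) (fun=> - k%:Z)| =
    (\prod_j (den_abs t (M 1 0, M 1 1) j)^-1 ^+ k)%:C%C.
  rewrite /mu_pow normr_prod rmorph_prod; apply: eq_bigr => j _.
  by rewrite -exprnN normfV normrX norm_den -rmorphXn -fmorphV -exprVn.
rewrite /poincare_term normrM norm_expC norm_mu_pow -[LHS]rmorphM /term_abs big_split.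
congr ((_ * _)%:C%C).
rewrite -expR_sum; congr expR; set w := tr_mul _ _ _.
have -> : complex.Re ((2 * pi)%:C%C * 'i%C * w) = - (2 * pi * complex.Im w).
  by case: w => x y; simpc => /=; ring.
rewrite sumrN -mulr_sumr -[X in _ = - X]mulrA; congr (- (_ * _)).
rewrite /w /tr_mul raddf_sum mulr_sumr; apply: eq_bigr => j _.
rewrite -Im_moebius_base_point // /cemb.
by case: (moebius _ _ _ _) => [x y]; simpc.
Qed.

Lemma moebius_scalar (a : F) (z : 'I_n -> R[i]) : a != 0 ->
  moebius sigma a%:M z =1 z.
Proof.
move=> a0 j; rewrite /moebius !mxE /cemb /= !mulr0n !mulr1n rmorph0 mul0r add0r addr0.
by rewrite mulrAC mulfV ?mul1r // !fmorph_eq0.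
Qed.

Lemma mu_pow_scalar (a : F) (z : 'I_n -> R[i]) (k : 'I_n -> int) :
  mu_pow sigma a%:M z k = \prod_j cemb sigma j a ^ k j.
Proof.
by apply: eq_bigr => j _; rewrite !mxE /cemb /= mulr0n mulr1n rmorph0 mul0r add0r.
Qed.

Lemma tr_mul_base_point t : tr_mul sigma nu (base_point t) = (0 +i* (t * n%:R))%C.
Proof.
transitivity (\sum_(j < n) (0 +i* t)%C : R[i]).
  apply: eq_bigr => j _; rewrite /cemb /base_point; simpc.
  by rewrite mulrC divfK // gt_eqF.
rewrite sumr_const card_ord; elim: (n) => [|m IH]; first by rewrite mulr0.
by rewrite mulrS IH; simpc; rewrite -natr1 mulrDr mulr1 addrC.
Qed.

(* The common value of the terms of the bottom rows [(0, 1)] and [(0, -1)]. *)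
Definition main_term t : R := expR (- (2 * pi * t * n%:R)).

Lemma poincare_term_sign t (k : nat) (b : bool) : ~~ odd (n * k) ->
  poincare_term sigma (fun=> k%:Z) nu (base_point t) ((-1) ^+ b)%:M =
  (main_term t)%:C%C.
Proof.
move=> even_nk; rewrite /poincare_term mu_pow_scalar.
have -> : \prod_j cemb sigma j ((-1) ^+ b) ^ (- k%:Z) = 1.
  transitivity (\prod_(j < n) ((-1) ^+ (b * k) : R[i])^-1).
    by apply: eq_bigr => j _; rewrite /cemb !rmorph_sign -exprnN -exprM.
  rewrite prodr_const card_ord invr_sign -exprM -signr_odd.
  by case: b => /=; rewrite ?mul1n ?mul0n // mulnC (negPf even_nk).
have -> : tr_mul sigma nu (moebius sigma ((-1) ^+ b)%:M (base_point t)) =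
    tr_mul sigma nu (base_point t).
  by apply: eq_bigr => j _; rewrite moebius_scalar ?signr_eq0.
rewrite tr_mul_base_point mul1r /expC; simpc => /=.
by rewrite cos0 sin0 mulr0 mulr1 /main_term -!mulrA.
Qed.

Lemma term_abs_ge0 t k p : 0 <= term_abs t k p.
Proof.
apply: prodr_ge0 => j _; rewrite mulr_ge0 ?expR_ge0 // exprn_ge0 // invr_ge0.
exact: den_abs_ge0.
Qed.

Lemma term_abs_addn_le t k l p a : 0 < a -> a <= \prod_j den_abs t p j ->
  term_abs t (l + k) p <= a^-1 ^+ l * term_abs t k p.
Proof.
move=> a0 a_le; have -> : term_abs t (l + k) p =
    (\prod_j den_abs t p j)^-1 ^+ l * term_abs t k p.
  rewrite /term_abs -prodfV -prodrXl -big_split; apply: eq_bigr => j _ /=.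
  by rewrite exprD mulrA.
have den0 : 0 < \prod_j den_abs t p j by apply: lt_le_trans a_le.
rewrite ler_wpM2r ?term_abs_ge0 // lerXn2r ?nnegrE ?invr_ge0 ?(ltW a0) ?(ltW den0) //.
by rewrite lef_pV2.
Qed.

Lemma height_snd_le t d g :
  height sigma d <= \prod_j (1 + den_abs t (g, d) j ^+ 2).
Proof.
apply: ler_prod => j _; rewrite addr_ge0 ?sqr_ge0 //= lerD2l den_abs_sqr.
by rewrite lerDl sqr_ge0.
Qed.

Lemma height_fst_le t d g : 1 <= t ->
  height sigma g <= height sigma nu * \prod_j (1 + den_abs t (g, d) j ^+ 2).
Proof.
move=> t1; rewrite /height -big_split /=; apply: ler_prod => j _.
rewrite addr_ge0 ?sqr_ge0 //= den_abs_sqr /=; have nu0 := nu_pos j.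
have : (sigma j g / sigma j nu) ^+ 2 <= (sigma j g * (t / sigma j nu)) ^+ 2.
  rewrite mulrCA [leRHS]exprMn ler_peMl ?sqr_ge0 // exprn_ege1 //.
have -> : sigma j g ^+ 2 = sigma j nu ^+ 2 * (sigma j g / sigma j nu) ^+ 2.
  by rewrite -exprMn mulrC divfK // gt_eqF.
have := sqr_ge0 (sigma j nu); have := sqr_ge0 (sigma j d).
have := sqr_ge0 (sigma j g / sigma j nu).
move: (_ ^+ 2) (_ ^+ 2) (_ ^+ 2) (_ ^+ 2) => x y z w; nra.
Qed.

(* Each of the heights of [g] and [d] is bounded by the product of the
   [1 + |g_j z_j + d_j|^2], and the exponentials bound the term of weight [4 n]
   by the power [- 2 n] of that product. *)
Lemma term_abs_le_height t g d : 1 <= t ->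
  term_abs t (4 * n) (g, d) <=
  (expR 1 * (2 * n)`!%:R) ^+ n * height sigma nu ^+ n *
  ((height sigma g)^-1 ^+ n * (height sigma d)^-1 ^+ n).
Proof.
move=> t1; set P := \prod_j (1 + den_abs t (g, d) j ^+ 2).
have P0 : 0 < P by apply: prodr_gt0 => j _; rewrite ltr_pwDl ?sqr_ge0.
apply: (@le_trans _ _ ((expR 1 * (2 * n)`!%:R) ^+ n * (P^-1 ^+ n * P^-1 ^+ n))).
  rewrite -exprD addnn -mul2n -prodfV -prodrXl -[n in _ ^+ n * _]card_ord -prodr_const.
  rewrite -big_split; apply: ler_prod => j _ /=.
  rewrite mulr_ge0 ?expR_ge0 ?exprn_ge0 ?invr_ge0 ?den_abs_ge0 //=.
  rewrite -[4%N]/(2 * 2)%N -mulnA; apply: exprV_expRN_le; last exact: den_abs_ge0.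
  by have := pi_ge2 R; nra.
rewrite -mulrA ler_wpM2l ?exprn_ge0 ?mulr_ge0 ?expR_ge0 // mulrA.
apply: ler_pM; rewrite ?exprn_ge0 ?invr_ge0 ?(ltW P0) //.
  rewrite -exprMn lerXn2r ?nnegrE ?mulr_ge0 ?invr_ge0 ?(ltW P0) ?height_ge0 //.
  by rewrite ler_pdivlMr ?height_gt0 // mulrC ler_pdivrMr // height_fst_le.
rewrite lerXn2r ?nnegrE ?invr_ge0 ?(ltW P0) ?height_ge0 //.
by rewrite lef_pV2 ?posrE ?height_gt0 // height_snd_le.
Qed.

End PoincareTerm.

(** * Cosets of [Gamma_inf] and their bottom rows *)

Lemma forall_ord2 (P : 'I_2 -> Prop) : P 0 -> P 1 -> forall i, P i.
Proof.
move=> P0 P1 [[|[|//]] lt_i2]; [move: P0 | move: P1]; congr P; exact: val_inj.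
Qed.

Section Cosets.
Variable F : fieldExtType rat.
Implicit Types (I : set F) (M N T : 'M[F]_2) (C : set 'M[F]_2).

Lemma SL2_OF_mul_Gamma_inf T M : Gamma_inf T -> SL2_OF M -> SL2_OF (T *m M).
Proof.
move=> GT [OM detM]; have [_ OT _ _] := GT.
have [TM00 TM01 TM10 TM11] := mul_Gamma_inf _ T M GT; split.
  do 2!apply: forall_ord2; rewrite ?TM00 ?TM01 ?TM10 ?TM11 //.
    by apply: ring_of_integersD => //; exact: ring_of_integersM.
  by apply: ring_of_integersD => //; exact: ring_of_integersM.
by move: detM; rewrite !det_mx2 TM00 TM01 TM10 TM11 => <-; ring.
Qed.

(* [N M^-1] is unipotent with upper right entry [N01 M00 - N00 M01]. *)
Lemma SL2_OF_same_bottom_row M N : SL2_OF M -> SL2_OF N ->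
  M 1 0 = N 1 0 -> M 1 1 = N 1 1 -> Gamma_inf_coset M N.
Proof.
move=> [OM detM] [ON detN] MN10 MN11.
pose mu := N 0 1 * M 0 0 - N 0 0 * M 0 1.
have Omu : ring_of_integers mu.
  by apply: ring_of_integersD; [|apply: ring_of_integersN]; exact: ring_of_integersM.
pose T : 'M[F]_2 := 1%:M + mu *: delta_mx 0 1.
have T01 : T 0 1 = mu by rewrite !mxE /= mulr1 add0r.
have GT : Gamma_inf T by split; rewrite ?T01 // !mxE /= ?mulr0 ?addr0.
have [TM00 TM01 TM10 TM11] := mul_Gamma_inf _ T M GT.
move: detM detN; rewrite !det_mx2 -MN10 -MN11 => detM detN.
exists T => //; apply/matrixP; do 2!apply: forall_ord2.
- transitivity (N 0 0 * (M 0 0 * M 1 1 - M 0 1 * M 1 0)); last by rewrite detM mulr1.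
  by rewrite TM00 T01 -[M 0 0 in LHS]mulr1 -detN /mu; ring.
- transitivity (N 0 1 * (M 0 0 * M 1 1 - M 0 1 * M 1 0)); last by rewrite detM mulr1.
  by rewrite TM01 T01 -[M 0 1 in LHS]mulr1 -detN /mu; ring.
- by rewrite TM10.
- by rewrite TM11.
Qed.

Lemma Gamma_inf_cosetP M N : SL2_OF M ->
  Gamma_inf_coset M N <-> [/\ SL2_OF N, N 1 0 = M 1 0 & N 1 1 = M 1 1].
Proof.
move=> SL_M; split=> [[T GT <-] | [SL_N NM10 NM11]]; last exact: SL2_OF_same_bottom_row.
have [_ _ TM10 TM11] := mul_Gamma_inf _ T M GT.
by split=> //; exact: SL2_OF_mul_Gamma_inf.
Qed.

Lemma Gamma_inf_coset_refl M : SL2_OF M -> Gamma_inf_coset M M.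
Proof. by move=> SL_M; apply/Gamma_inf_cosetP. Qed.

Lemma Gamma_inf_coset_eq M N : SL2_OF M -> SL2_OF N ->
  M 1 0 = N 1 0 -> M 1 1 = N 1 1 -> Gamma_inf_coset M = Gamma_inf_coset N.
Proof.
move=> SL_M SL_N MN10 MN11; apply/seteqP; split=> L.
  move=> /(Gamma_inf_cosetP _ SL_M)[SL_L LM10 LM11].
  by apply/Gamma_inf_cosetP; rewrite -?MN10 -?MN11.
move=> /(Gamma_inf_cosetP _ SL_N)[SL_L LN10 LN11].
by apply/Gamma_inf_cosetP; rewrite ?MN10 ?MN11.
Qed.

Definition bottom_row C : F * F := (xget 1%:M C 1 0, xget 1%:M C 1 1).

Lemma Gamma_inf_coset_rep M : SL2_OF M ->
  Gamma_inf_coset M (xget 1%:M (Gamma_inf_coset M)).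
Proof. by move=> SL_M; apply: xgetPex; exists M; exact: Gamma_inf_coset_refl. Qed.

Lemma bottom_row_coset M : SL2_OF M ->
  bottom_row (Gamma_inf_coset M) = (M 1 0, M 1 1).
Proof.
move=> SL_M; rewrite /bottom_row.
by have /(Gamma_inf_cosetP _ SL_M)[_ -> ->] := Gamma_inf_coset_rep SL_M.
Qed.

Lemma bottom_row_inj I C C' : Gamma_inf_quot I C -> Gamma_inf_quot I C' ->
  bottom_row C = bottom_row C' -> C = C'.
Proof.
move=> [M [SL_M _] <-] [N [SL_N _] <-]; rewrite !bottom_row_coset // => -[? ?].
exact: Gamma_inf_coset_eq.
Qed.

Lemma quot_rep_SL2 I C : Gamma_inf_quot I C -> SL2_OF (xget 1%:M C).
Proof.
by move=> [M [SL_M _] <-]; have /(Gamma_inf_cosetP _ SL_M)[] := Gamma_inf_coset_rep SL_M.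
Qed.

Definition integer_pairs : set (F * F) := @ring_of_integers F `*` @ring_of_integers F.

Lemma bottom_row_integral I C : Gamma_inf_quot I C -> integer_pairs (bottom_row C).
Proof. by move=> /quot_rep_SL2[OM _]; split; exact: OM. Qed.

Definition integer_units : set F :=
  [set d | [/\ d != 0, ring_of_integers d & ring_of_integers d^-1]].

Definition nontrivial_units : set F := [set d | [/\ integer_units d, d != 1 & d != -1]].

Lemma bottom_row_unit I C : Gamma_inf_quot I C -> (bottom_row C).1 = 0 ->
  integer_units (bottom_row C).2.
Proof.
move=> quot_C row1_0; have [OM detM] := quot_rep_SL2 quot_C.
have ad : xget 1%:M C 0 0 * (bottom_row C).2 = 1.
  by move: detM; rewrite det_mx2 (row1_0 : xget 1%:M C 1 0 = 0) mulr0 subr0.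
have d0 : (bottom_row C).2 != 0.
  by apply: contra_eq_neq ad => ->; rewrite mulr0 eq_sym oner_eq0.
split=> //; first exact: OM.
by rewrite -[_^-1]mul1r -ad mulfK //; exact: OM.
Qed.

Lemma SL2_OF_sign (b : bool) : SL2_OF (((-1) ^+ b)%:M : 'M[F]_2).
Proof.
split; last by rewrite det_scalar sqrr_sign.
move=> i j; rewrite mxE; case: (i == j); last exact: ring_of_integers0.
by case: b; [apply: ring_of_integersN|]; exact: ring_of_integers1.
Qed.

Definition sign_coset (b : bool) : set 'M[F]_2 := Gamma_inf_coset ((-1) ^+ b)%:M.

Lemma bottom_row_sign_coset b : bottom_row (sign_coset b) = (0, (-1) ^+ b).
Proof. by rewrite bottom_row_coset ?mxE //; exact: SL2_OF_sign. Qed.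

Lemma Gamma0_sign I (b : bool) : integral_ideal I ->
  Gamma0 I (((-1) ^+ b)%:M : 'M[F]_2).
Proof. by move=> [_ I0 _ _]; split; [exact: SL2_OF_sign | rewrite mxE]. Qed.

Lemma quot_sign_coset I b : integral_ideal I -> Gamma_inf_quot I (sign_coset b).
Proof. by move=> idealI; exists ((-1) ^+ b)%:M => //; exact: Gamma0_sign. Qed.

Lemma sign_coset_neq : sign_coset false <> sign_coset true.
Proof.
move=> /(congr1 bottom_row); rewrite !bottom_row_sign_coset => -[/eqP].
rewrite expr0 expr1 -subr_eq0 opprK -mulr2n -(rmorph_nat (in_alg F)) fmorph_eq0.
by rewrite pnatr_eq0.
Qed.

Definition sign_cosets : set (set 'M[F]_2) := [set sign_coset false; sign_coset true].

Lemma fsets_sign_cosets I : integral_ideal I -> fsets (Gamma_inf_quot I) sign_cosets.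
Proof.
move=> idealI; split; first by rewrite /sign_cosets /= finite_setU.
by move=> _ [->|->]; exact: quot_sign_coset.
Qed.

Lemma quot_eq_sign_coset I C (b : bool) : integral_ideal I -> Gamma_inf_quot I C ->
  bottom_row C = (0, (-1) ^+ b) -> C = sign_coset b.
Proof.
move=> idealI quot_C rowC; apply: (bottom_row_inj quot_C (quot_sign_coset b idealI)).
by rewrite bottom_row_sign_coset.
Qed.

End Cosets.

Arguments integer_pairs : clear implicits.
Arguments sign_cosets : clear implicits.
Arguments nontrivial_units : clear implicits.

(** * Size of the terms of the series *)

Section Series.
Variables (R : realType) (F : fieldExtType rat) (n : nat).
Variables (sigma : 'I_n -> {rmorphism F -> R}) (nu : F).
Hypothesis degF : \dim {:F} = n.
Hypothesis embF : enumerates_real_embeddings sigma.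
Hypothesis nu_dual : dual_of_integers sigma nu.
Hypothesis nu_pos : totally_positive sigma nu.

Let normF_ge1 := normF_integer_ge1 degF embF nu_dual nu_pos.

Lemma bounded_sums_term_abs t : 1 <= t -> exists B,
  bounded_sums (integer_pairs F)
    (term_abs sigma nu t (4 * n)) B.
Proof.
move=> t1; have [B sum_height] := bounded_sums_height degF embF nu_dual nu_pos.
have height_inv_ge0 x : 0 <= (height sigma x)^-1 ^+ n.
  by rewrite exprn_ge0 // invr_ge0 height_ge0.
pose K := (expR 1 * (2 * n)`!%:R) ^+ n * height sigma nu ^+ n.
have K0 : 0 <= K by rewrite mulr_ge0 ?exprn_ge0 ?mulr_ge0 ?expR_ge0 ?height_ge0.
have sum_pairs := bounded_sums_prod height_inv_ge0 height_inv_ge0 sum_height sum_height.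
exists (K * (B * B)); apply: bounded_sums_le (bounded_sumsZ K0 sum_pairs) => -[g d] _.
exact: term_abs_le_height.
Qed.

Lemma prod_den_abs_ge t g d : 1 <= t -> ring_of_integers g -> g != 0 ->
  t / normF sigma nu <= \prod_j den_abs sigma nu t (g, d) j.
Proof.
move=> t1 Og g0; have t0 : 0 < t by apply: lt_le_trans t1.
have Nnu0 := normF_gt0 nu_pos.
apply: (@le_trans _ _ (`|normF sigma g| * (t ^+ n / normF sigma nu))).
  apply: (@le_trans _ _ (t ^+ n / normF sigma nu)).
    by rewrite ler_pM2r ?invr_gt0 // ler_eXnr // (deg_gt0 degF).
  by rewrite ler_peMl ?normF_ge1 // divr_ge0 ?exprn_ge0 ?ltW.
rewrite /normF normr_prod -[n in t ^+ n]card_ord -prodr_const -prodfV -!big_split /=.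
apply: ler_prod => j _; rewrite (ler_fst_den_abs nu_pos) ?(ltW t0) // andbT.
by rewrite mulr_ge0 // divr_ge0 ?(ltW t0) // ltW.
Qed.

Section Units.
Variable d : F.
Hypothesis unit_d : integer_units d.

Lemma normF_unit : `|normF sigma d| = 1.
Proof.
have [d0 Od OdV] := unit_d; apply/eqP; rewrite eq_le normF_ge1 // andbT.
have := normF_ge1 OdV; rewrite invr_eq0 normFV normfV => /(_ d0).
by rewrite invf_ge1 ?normr_gt0 ?normF_neq0.
Qed.

Lemma den_abs_unit t j : den_abs sigma nu t (0, d) j = `|sigma j d|.
Proof. by rewrite /den_abs rmorph0 mul0r expr0n addr0 sqrtr_sqr. Qed.

Lemma prod_den_abs_unit t : \prod_j den_abs sigma nu t (0, d) j = 1.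
Proof. by under eq_bigr do rewrite den_abs_unit; rewrite -normr_prod normF_unit. Qed.

Lemma term_abs_unit t k :
  term_abs sigma nu t k (0, d) = expR (- (2 * pi * t * trF sigma (d ^- 2))).
Proof.
rewrite /term_abs big_split /= prodrXl prodfV prod_den_abs_unit invr1 expr1n mul1r.
rewrite -expR_sum sumrN mulr_sumr; congr (expR (- _)); apply: eq_bigr => j _.
by rewrite den_abs_unit real_normK ?num_real // fmorphV rmorphXn.
Qed.

Lemma trF_unit_gt : d != 1 -> d != -1 -> n%:R < trF sigma (d ^- 2).
Proof.
have [d0 _ _] := unit_d => d1 dN1; apply: trF_gt_deg => //.
- by move=> j; rewrite fmorphV rmorphXn invr_gt0 exprn_even_gt0 // fmorph_eq0.
- by rewrite normFV normFX -real_normK ?num_real // normF_unit expr1n invr1.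
- by rewrite invr_eq1 sqrf_eq1 negb_or d1.
Qed.

End Units.

Lemma nontrivial_units_negligible (a e : R) : 0 < e -> exists2 t, a <= t &
  forall k, bounded_sums (nontrivial_units F) (fun d => term_abs sigma nu t k (0, d))
    (e * main_term n t).
Proof.
move=> e0; pose q d := expR (- (2 * pi * (trF sigma (d ^- 2) - n%:R))).
have [B sum1] := bounded_sums_term_abs (lexx 1).
have q01 d : nontrivial_units F d -> 0 <= q d < 1.
  move=> [unit_d d1 dN1]; rewrite expR_ge0 -[ltRHS]expR0 ltr_expR oppr_lt0.
  by rewrite !mulr_gt0 ?pi_gt0 // subr_gt0 trF_unit_gt.
have sum_q : bounded_sums (nontrivial_units F) q (expR (2 * pi * n%:R) * B).
  apply: (bounded_sums_le_inj (h := pair 0)) (bounded_sumsZ (expR_ge0 _) sum1).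
  - by move=> d [[_ Od _] _ _]; split=> //=; exact: ring_of_integers0.
  - by move=> d d' _ _ [].
  - move=> d [unit_d _ _]; rewrite term_abs_unit // -expRD /q ler_expR le_eqVlt.
    by apply/orP; left; apply/eqP; ring.
have [N small] := bounded_sums_exprn e0 q01 sum_q.
exists (N + Num.bound `|a|)%:R => [|k].
  apply: le_trans (ler_norm a) (ltW (lt_le_trans (archi_boundP (normr_ge0 a)) _)).
  by rewrite ler_nat leq_addl.
rewrite mulrC; have small_t := small _ (leq_addr (Num.bound `|a|) N).
apply: bounded_sums_le (bounded_sumsZ (expR_ge0 _) small_t) => d [unit_d _ _].
rewrite term_abs_unit // -expRM_natl -expRD ler_expR le_eqVlt.
by apply/orP; left; apply/eqP; ring.
Qed.

Variable I : set F.
Hypothesis idealI : integral_ideal I.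

Lemma prod_den_abs_ge1 t C : 1 <= t -> normF sigma nu <= t -> Gamma_inf_quot I C ->
  1 <= \prod_j den_abs sigma nu t (bottom_row C) j.
Proof.
move=> t1 tN quot_C; have [Og Od] := bottom_row_integral quot_C.
have := @bottom_row_unit _ _ _ quot_C; case: (bottom_row C) Og Od => g d /= Og Od unit_d.
have [g0|g0] := eqVneq g 0; first by rewrite g0 prod_den_abs_unit //; exact: unit_d.
apply: le_trans (prod_den_abs_ge d t1 Og g0).
by rewrite ler_pdivlMr ?normF_gt0 // mul1r.
Qed.

Lemma bounded_sums_quot t k l B : 1 <= t -> normF sigma nu <= t ->
  bounded_sums (integer_pairs F) (term_abs sigma nu t k) B ->
  bounded_sums (Gamma_inf_quot I)
    (fun C => term_abs sigma nu t (l + k) (bottom_row C)) B.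
Proof.
move=> t1 tN; apply: (bounded_sums_le_inj (h := @bottom_row F)).
- by move=> C /bottom_row_integral.
- by move=> C C'; exact: bottom_row_inj.
- move=> C quot_C; have := term_abs_addn_le k l ltr01 (prod_den_abs_ge1 t1 tN quot_C).
  by rewrite invr1 expr1n mul1r.
Qed.

Lemma bounded_sums_units t k c :
  bounded_sums (nontrivial_units F) (fun d => term_abs sigma nu t k (0, d)) c ->
  bounded_sums [set C | (Gamma_inf_quot I `\` sign_cosets F) C /\ (bottom_row C).1 == 0]
    (fun C => term_abs sigma nu t k (bottom_row C)) c.
Proof.
have rowE C : (bottom_row C).1 == 0 -> bottom_row C = (0, (bottom_row C).2).
  by case: (bottom_row C) => g d /= /eqP ->.
apply: (bounded_sums_le_inj (h := fun C => (bottom_row C).2)).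
- move=> C [[quot_C nsign] g0]; split; first exact: (bottom_row_unit quot_C (eqP g0)).
    apply: contra_notT nsign => /negPn/eqP d1; left.
    by apply: (quot_eq_sign_coset idealI quot_C); rewrite rowE // d1.
  apply: contra_notT nsign => /negPn/eqP d1; right.
  by apply: (quot_eq_sign_coset idealI quot_C); rewrite rowE // d1.
- move=> C C' [[quot_C _] g0] [[quot_C' _] g0'] dd'.
  by apply: (bottom_row_inj quot_C quot_C'); rewrite rowE // dd' -rowE.
- by move=> C [_ g0]; rewrite -rowE.
Qed.

Lemma bounded_sums_nonunits t k l B : 1 <= t -> 2 * normF sigma nu <= t ->
  bounded_sums (integer_pairs F) (term_abs sigma nu t k) B ->
  bounded_sums [set C | Gamma_inf_quot I C /\ (bottom_row C).1 != 0]
    (fun C => term_abs sigma nu t (l + k) (bottom_row C)) (2^-1 ^+ l * B).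
Proof.
move=> t1 t2N sumB; have half0 : 0 <= (2^-1 : R) ^+ l by rewrite exprn_ge0 // invr_ge0.
apply: (bounded_sums_le_inj (h := @bottom_row F)) (bounded_sumsZ half0 sumB).
- by move=> C [/bottom_row_integral].
- by move=> C C' [quot_C _] [quot_C' _]; exact: (bottom_row_inj quot_C quot_C').
- move=> C [quot_C g0]; have [Og _] := bottom_row_integral quot_C.
  apply: term_abs_addn_le => //; rewrite [bottom_row C]surjective_pairing.
  apply: le_trans (prod_den_abs_ge _ t1 Og g0).
  by rewrite ler_pdivlMr // normF_gt0.
Qed.

Lemma hilbert_poincare_base_point t k l B c : 1 <= t -> 2 * normF sigma nu <= t ->
  ~~ odd (n * (l + k)) ->
  bounded_sums (integer_pairs F) (term_abs sigma nu t k) B ->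
  bounded_sums (nontrivial_units F) (fun d => term_abs sigma nu t (l + k) (0, d)) c ->
  `|hilbert_poincare sigma (fun=> (l + k)%N%:Z) nu I (base_point sigma nu t) -
    (2 * main_term n t)%:C%C| <= (c + 2^-1 ^+ l * B)%:C%C.
Proof.
move=> t1 t2N even_nk sumB sumc; have t0 : 0 < t by apply: lt_le_trans t1.
have zH := base_point_upper nu_pos t0.
have tN : normF sigma nu <= t by have := normF_gt0 nu_pos; lra.
set z := base_point sigma nu t in zH *; set m := (l + k)%N in even_nk sumc *.
pose f C := poincare_term sigma (fun=> m%:Z) nu z (xget 1%:M C).
pose g C := term_abs sigma nu t m (bottom_row C).
have fg C : Gamma_inf_quot I C -> `|f C| <= (g C)%:C%C.
  by move=> /quot_rep_SL2[_ detM]; rewrite /f norm_poincare_term.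
have : has_sum (Gamma_inf_quot I) f (hilbert_poincare sigma (fun=> m%:Z) nu I z).
  by apply: xgetPex; apply: has_sum_majorant fg (bounded_sums_quot _ t1 tN sumB).
have tail : bounded_sums (Gamma_inf_quot I `\` sign_cosets F) g (c + 2^-1 ^+ l * B).
  apply: (bounded_sumsID (P := fun C => (bottom_row C).1 == 0)).
    exact: bounded_sums_units.
  apply: bounded_sums_sub (bounded_sums_nonunits _ t1 t2N sumB).
  by move=> C [[quot_C _] g0].
move=> /has_sum_dist/(_ (fsets_sign_cosets idealI) fg tail).
suff -> : \sum_(C \in sign_cosets F) f C = (2 * main_term n t)%:C%C by [].
have f_sign b : f (@sign_coset F b) = (main_term n t)%:C%C.
  have Gb := Gamma0_sign b idealI.
  rewrite /f (poincare_term_rep _ _ _ _ _ I nu_dual _ zH _ _ _ Gb erefl).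
  exact: poincare_term_sign.
rewrite fsbigU0 //; last by move=> _ [-> /sign_coset_neq].
by rewrite !fsbig_set1 !f_sign mulr_natl mulr2n rmorphD.
Qed.

End Series.

Theorem theorem4p1 (R : realType) (F : fieldExtType rat) (n : nat)
    (sigma : 'I_n -> {rmorphism F -> R}) (nu : F) (I : set F)
    (degF : \dim {:F} = n) (realF : totally_real F R)
    (embF : enumerates_real_embeddings sigma)
    (nu_dual : dual_of_integers sigma nu) (nu_pos : totally_positive sigma nu)
    (idealI : integral_ideal I) (I_neq0 : nonzero_ideal I) :
  exists2 k0 : R, 0 < k0 &
    forall k : int, k0 < k%:~R -> 2 < k -> (2 %| n%:Z * k)%Z ->
      ~ (forall z, upper_half_space z ->
           hilbert_poincare sigma (fun=> k) nu I z = 0).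
Proof.
have Nnu0 := normF_gt0 nu_pos.
have [t t_ge units_small] := nontrivial_units_negligible degF embF nu_dual nu_pos
  (1 + 2 * normF sigma nu) ltr01.
have [t1 t2N] : 1 <= t /\ 2 * normF sigma nu <= t by lra.
have [B sumB] := bounded_sums_term_abs degF embF nu_dual nu_pos t1.
have main0 : 0 < main_term n t := expR_gt0 _.
pose L := Num.bound (B / main_term n t).
exists (L + 4 * n).+1%:R => [|k k_gt _ even_nk vanish]; first by rewrite ltr0n.
have [l Ll kE] : exists2 l, (L <= l)%N & k = (l + 4 * n)%N.
  move: k_gt; rewrite pmulrn ltr_int => k_gt.
  by exists (`|k| - 4 * n)%N; lia.
have {}even_nk : ~~ odd (n * (l + 4 * n)).
  by move: even_nk; rewrite kE dvdzE abszM /= dvdn2.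
have tail_small : 2^-1 ^+ l * B < main_term n t.
  by rewrite exprVn mulrC ltr_pdivrMr ?exprn_gt0 // mulrC -ltr_pdivrMr // upper_nthrootP.
have := hilbert_poincare_base_point degF embF nu_dual nu_pos idealI t1 t2N
  even_nk sumB (units_small _).
rewrite -kE vanish ?sub0r; last by apply: base_point_upper => //; lra.
rewrite normrN ger0_norm ?lecR ?mulr_ge0 ?(ltW main0) //; lra.
Qed.
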